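(* Let $n,p,m,n_o,\nu\ge1$ be integers, let $F:\mathbb{R}^n\to\mathbb{R}^n$, $G:\mathbb{R}^n\to\mathbb{R}^n$, $H:\mathbb{R}^n\to\mathbb{R}^p$, $J:\mathbb{R}^n\to\mathbb{R}^p$, $E:\mathbb{R}^n\to\mathbb{R}^{n\times m}$, $K:\mathbb{R}^n\to\mathbb{R}^{p\times m}$ be smooth, and let $R\in\mathbb{R}^{n_o\times n_o}$, $Q\in\mathbb{R}^{1\times n_o}$. Consider the system $$\frac{dx}{dt}=F(x)+G(x)Qx_o+E(x)W,\qquad \frac{dx_o}{dt}=Rx_o,\qquad y=H(x)+J(x)Qx_o+K(x)W,\qquad z=Qx_o,$$ with $x\in\mathbb{R}^n$, $x_o\in\mathbb{R}^{n_o}$, $W\in\mathbb{R}^m$. Let $\lambda^\nu+\alpha_1\lambda^{\nu-1}+\cdots+\alpha_{\nu-1}\lambda+\alpha_\nu$ be a polynomial with real coefficients, all of whose roots have negative real part. Then there exists a functional observer $$\frac{d\hat\xi}{dt}=A\hat\xi+By,\qquad \hat f=C\hat\xi+Dy,$$ with $A\in\mathbb{R}^{\nu\times\nu}$, $B\in\mathbb{R}^{\nu\times p}$, $C\in\mathbb{R}^{1\times\nu}$, $D\in\mathbb{R}^{1\times p}$, for this system such that the eigenvalues of $A$ (counted with multiplicity) are the roots of the given polynomial, if and only if there exist constant row vectors $\beta_0,\beta_1,\ldots,\beta_\nu\in\mathbb{R}^p$ (regarded as $1\times p$ matrices) such that for all $(x,x_o)\in\mathbb{R}^n\times\mathbb{R}^{n_o}$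 $$L_{F_e}^\nu\big(\beta_0(H(x)+J(x)Qx_o)\big)+L_{F_e}^{\nu-1}\big(\beta_1(H(x)+J(x)Qx_o)\big)+\cdots+L_{F_e}\big(\beta_{\nu-1}(H(x)+J(x)Qx_o)\big)+\beta_\nu\big(H(x)+J(x)Qx_o\big)$$ $$=Q\big(R^\nu+\alpha_1R^{\nu-1}+\cdots+\alpha_{\nu-1}R+\alpha_\nu I\big)x_o.$$
   Context: The operator $L_{F_e}$ is the Lie derivative along the extended disturbance-free dynamics on $\mathbb{R}^n\times\mathbb{R}^{n_o}$: $$L_{F_e}=\sum_{k=1}^nF_k(x)\frac{\partial}{\partial x_k}+Qx_o\sum_{k=1}^nG_k(x)\frac{\partial}{\partial x_k}+\sum_{k=1}^{n_o}R_kx_o\frac{\partial}{\partial x_{o_k}},$$ where $R_k$ is the $k$-th row of $R$; $L_{F_e}^j$ is its $j$-fold iterate. Definition (functional observer). The system $\frac{d\hat\xi}{dt}=A\hat\xi+By$, $\hat f=C\hat\xi+Dy$, with constant real matrices $A,B,C,D$ of sizes $\nu\times\nu$, $\nu\times p$, $1\times\nu$, $1\times p$ and $A$ having stable eigenvalues (all with negative real part), is a functional observer for the given system if there exists a differentiable mapping $T:\mathbb{R}^{n+n_o}\to\mathbb{R}^\nu$ such that for all $(x,x_o)\in\mathbb{R}^n\times\mathbb{R}^{n_o}$: (i) $\frac{\partial T}{\partial x}(x,x_o)\big(F(x)+G(x)Qx_o\big)+\frac{\partial T}{\partial x_o}(x,x_o)Rx_o=AT(x,x_o)+B\big(H(x)+J(x)Qx_o\big)$;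 (ii) $CT(x,x_o)+D\big(H(x)+J(x)Qx_o\big)=Qx_o$. (No condition involving the disturbance terms $E,K$ is imposed in this definition.) *)

(* Defs.v *)
From HB Require Import structures.
From mathcomp Require Import all_boot all_order all_algebra.
From mathcomp Require Import all_classical all_reals all_analysis.
From mathcomp Require Import complex.

Set Implicit Arguments.
Unset Strict Implicit.
Unset Printing Implicit Defensive.

Import Order.TTheory GRing.Theory Num.Theory.
Import numFieldNormedType.Exports.

Local Open Scope ring_scope.

(* C^k maps on R^n, by recursion on k.  As R^n is finite dimensional, the
   differential is C^k as a map into the space of linear maps iff each of its
   evaluations x |-> 'd f x v is. *)
Fixpoint class_C (R : realType) (n : nat) (W : normedModType R) (k : nat)
    (f : 'cV[R]_n -> W) : Prop :=
  if k is k'.+1 then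
    (forall x, differentiable f x) /\ (forall v, class_C k' (fun x => 'd f x v))
  else continuous f.

Definition smooth (R : realType) (n : nat) (W : normedModType R)
    (f : 'cV[R]_n -> W) : Prop := forall k, class_C k f.

(* The system
     dx/dt = F(x) + G(x) Q x_o + E(x) W,   dx_o/dt = R x_o,
         y = H(x) + J(x) Q x_o + K(x) W,         z = Q x_o,
   where sysR is the matrix R (the name R being taken by the real numbers). *)
Record exo_system (R : realType) (n p m no : nat) := ExoSystem {
  sysF : 'cV[R]_n -> 'cV[R]_n;
  sysG : 'cV[R]_n -> 'cV[R]_n;
  sysH : 'cV[R]_n -> 'cV[R]_p;
  sysJ : 'cV[R]_n -> 'cV[R]_p;
  sysE : 'cV[R]_n -> 'M[R]_(n, m);
  sysK : 'cV[R]_n -> 'M[R]_(p, m);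
  sysR : 'M[R]_no;
  sysQ : 'rV[R]_no;
  smooth_sysF : smooth sysF;
  smooth_sysG : smooth sysG;
  smooth_sysH : smooth sysH;
  smooth_sysJ : smooth sysJ;
  smooth_sysE : smooth sysE;
  smooth_sysK : smooth sysK
}.

Section Observer.
Variables (R : realType) (n p m no : nat).
Implicit Types (sys : exo_system R n p m no) (w : 'cV[R]_n * 'cV[R]_no).

(* Points (x, x_o) of R^(n + no) are pairs w. *)

Definition free_output sys w : 'cV[R]_p :=
  sysH sys w.1 + sysJ sys w.1 *m (sysQ sys *m w.2).

Definition pd_x (k : 'I_n) (phi : 'cV[R]_n * 'cV[R]_no -> R) w : R :=
  'D_((delta_mx k 0, 0) : 'cV[R]_n * 'cV[R]_no) phi w.

Definition pd_xo (k : 'I_no) (phi : 'cV[R]_n * 'cV[R]_no -> R) w : R :=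
  'D_((0, delta_mx k 0) : 'cV[R]_n * 'cV[R]_no) phi w.

Definition jac_x (nu : nat) (T : 'cV[R]_n * 'cV[R]_no -> 'cV[R]_nu) w :
  'M[R]_(nu, n) := \matrix_(i, k) pd_x k (fun w' => T w' i 0) w.

Definition jac_xo (nu : nat) (T : 'cV[R]_n * 'cV[R]_no -> 'cV[R]_nu) w :
  'M[R]_(nu, no) := \matrix_(i, k) pd_xo k (fun w' => T w' i 0) w.

Definition lie_Fe sys (phi : 'cV[R]_n * 'cV[R]_no -> R) :
    'cV[R]_n * 'cV[R]_no -> R := fun w =>
  \sum_(k < n) sysF sys w.1 k 0 * pd_x k phi w
  + (sysQ sys *m w.2) 0 0 * (\sum_(k < n) sysG sys w.1 k 0 * pd_x k phi w)
  + \sum_(k < no) (row k (sysR sys) *m w.2) 0 0 * pd_xo k phi w.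

Definition stable (nu : nat) (A : 'M[R]_nu) : Prop :=
  forall z : R[i],
    eigenvalue (map_mx (real_complex R) A) z -> complex.Re z < 0.

Definition functional_observer sys (nu : nat) (A : 'M[R]_nu)
    (B : 'M[R]_(nu, p)) (C : 'rV[R]_nu) (D : 'rV[R]_p) : Prop :=
  stable A /\
  exists T : 'cV[R]_n * 'cV[R]_no -> 'cV[R]_nu,
    (forall w, differentiable T w) /\
    (forall x xo,
      jac_x T (x, xo) *m (sysF sys x + sysG sys x *m (sysQ sys *m xo))
        + jac_xo T (x, xo) *m (sysR sys *m xo)
      = A *m T (x, xo) + B *m free_output sys (x, xo)) /\
    (forall x xo,
      C *m T (x, xo) + D *m free_output sys (x, xo) = sysQ sys *m xo).

End Observer.

(* lambda^nu + alpha_1 lambda^(nu-1) + ... + alpha_nu, where alpha_(k+1) is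
   stored as alpha k for k < nu. *)
Definition monic_of (R : realType) (nu : nat) (alpha : 'I_nu -> R) : {poly R} :=
  'X^nu + \sum_(k < nu) alpha k *: 'X^(nu - k.+1).

Definition complexified (R : realType) (q : {poly R}) : {poly R[i]} :=
  map_poly (real_complex R) q.

(* The eigenvalues of A, with algebraic multiplicity, are the complex roots of
   q, with multiplicity. *)
Definition eigenvalues_are_roots (R : realType) (nu : nat) (A : 'M[R]_nu)
    (q : {poly R}) : Prop :=
  forall z : R[i],
    mup z (char_poly (map_mx (real_complex R) A)) = mup z (complexified q).

(* Main.v *)
From HB Require Import structures.
Require Import Defs.
From mathcomp Require Import all_boot all_order all_algebra.
From mathcomp Require Import all_classical all_reals all_analysis.
From mathcomp Require Import complex ring.

Import Order.TTheory GRing.Theory Num.Theory.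
Import numFieldNormedType.Exports.

Local Open Scope ring_scope.

(** Write L for the derivation lie_Fe, h for the disturbance-free output
    H(x) + J(x) Q xo, z = Q xo for the functional to be observed, and
    q = X^nu + q_(nu-1) X^(nu-1) + ... + q_0 for the prescribed polynomial.
    Since dxo/dt = R xo is linear, L^k z = Q R^k xo, so that the identity to be
    characterized reads sum_j L^(nu-j) (beta_j h) = q(L) z.

    From an observer to the identity: condition (i) says L T = A T + B h, hence
    by induction L^k (c T) = c A^k T + sum_(i<k) L^i (c A^(k-1-i) B h) for every
    constant row c (iter_lie_Fe_observer).  Condition (ii) says z = C T + D h.
    In the combination q(L) z the terms C A^k T add up to C q(A) T, which
    vanishes by Cayley-Hamilton because q is the characteristic polynomial of A;
    only constant combinations of the L^i h remain
    (observer_output_identity).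

    From the identity to an observer: put u_j = q_(nu-j) z - beta_j h and
    S_k = sum_(j<=k) L^(k-j) u_j.  Then L S_k = S_(k+1) - u_(k+1), and the
    identity says exactly that S_nu = 0, so that the chain S_0, ..., S_(nu-1)
    closes up.  As S_0 = z - beta_0 h, one can replace z by S_0 + beta_0 h in
    u_(k+1), and the relations become a linear system driven by h in observer
    canonical form, whose matrix is a transposed companion matrix of q
    (observer_of_output_identity).

    Three points need care.  The map T of a given observer is only
    differentiable; but L T = A T + B h expresses each L^k (c T) through T and
    smooth functions, so these iterates exist and L is additive on them.  The
    Lie derivatives of h must be differentiable for the chain S_k to be an
    admissible T, which is a matter of closing smooth functions under sums,
    products and directional derivatives.  Finally, the eigenvalues of A are
    the roots of q with multiplicity precisely when q is the characteristic
    polynomial, both being monic over the reals and split over the complex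
    numbers. *)

(** * The prescribed characteristic polynomial *)

Lemma monic_eq_mup {F : closedFieldType} (p q : {poly F}) :
  p \is monic -> q \is monic -> (forall z, mup z p = mup z q) -> p = q.
Proof.
move=> /monicP p1 /monicP q1.
have [r ->] := closed_field_poly_normal p.
have [s ->] := closed_field_poly_normal q.
rewrite p1 q1 !scale1r => eq_mup; apply: perm_big; apply/allP => z _ /=.
by rewrite -!mu_prod_XsubC eq_mup.
Qed.

(** Collecting the scattered monomials by degree makes the coefficients and
    the size readable. *)
Lemma monic_ofE {R : realType} {nu : nat} (alpha : 'I_nu -> R) :
  monic_of alpha = 'X^nu + \poly_(i < nu)
     \sum_(k < nu | (nu - k.+1)%N == i) alpha k.
Proof.
rewrite /monic_of poly_def; congr (_ + _).
under [RHS]eq_bigr do rewrite scaler_suml big_mkcond.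
rewrite exchange_big/=; apply: eq_bigr => k _.
have lt_k : (nu - k.+1 < nu)%N by rewrite ltn_subrL (leq_ltn_trans _ (ltn_ord k)).
rewrite (bigD1 (Ordinal lt_k))//= eqxx big1 ?addr0// => i.
by rewrite -val_eqE/= eq_sym => /negbTE ->.
Qed.

Lemma coef_monic_of {R : realType} {nu : nat} (alpha : 'I_nu -> R) (k : 'I_nu) :
  (monic_of alpha)`_(nu - k.+1) = alpha k.
Proof.
have lt_k : (nu - k.+1 < nu)%N by rewrite ltn_subrL (leq_ltn_trans _ (ltn_ord k)).
rewrite monic_ofE coefD coefXn coef_poly lt_k ltn_eqF// add0r.
rewrite (bigD1 k)//= big1 ?addr0// => i /andP[/eqP eq_ik /eqP[]].
apply: val_inj; apply/eqP; rewrite -eqSS -(eqn_add2l (nu - i.+1)).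
by rewrite {2}eq_ik !subnK.
Qed.

Lemma coef_monic_of_lead {R : realType} {nu : nat} (alpha : 'I_nu -> R) :
  (monic_of alpha)`_nu = 1.
Proof. by rewrite monic_ofE coefD coefXn coef_poly ltnn eqxx addr0. Qed.

Lemma size_monic_of {R : realType} {nu : nat} (alpha : 'I_nu -> R) :
  size (monic_of alpha) = nu.+1.
Proof. by rewrite monic_ofE size_addl size_polyXn// ltnS size_poly. Qed.

Lemma monic_of_monic {R : realType} {nu : nat} (alpha : 'I_nu -> R) :
  monic_of alpha \is monic.
Proof. by rewrite monicE /lead_coef size_monic_of coef_monic_of_lead. Qed.

Lemma monic_of_eval {R : realType} {nu no : nat} (alpha : 'I_nu -> R)
    (M : 'M[R]_no) :
  M ^+ nu + \sum_(k < nu) alpha k *: M ^+ (nu - k.+1)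
    = \sum_(k < nu.+1) (monic_of alpha)`_k *: M ^+ k.
Proof.
rewrite big_ord_recr/= coef_monic_of_lead scale1r addrC; congr (_ + _).
rewrite [RHS](reindex_inj rev_ord_inj)/=.
by under [RHS]eq_bigr do rewrite coef_monic_of.
Qed.

(** Over the algebraically closed field of complex numbers a monic polynomial is
    determined by the multiplicities of its roots, and the embedding of the
    reals is injective on polynomials. *)
Lemma eigenvalues_are_rootsP {R : realType} {nu : nat} (A : 'M[R]_nu)
    (q : {poly R}) : q \is monic ->
  eigenvalues_are_roots A q <-> char_poly A = q.
Proof.
move=> q1; rewrite /eigenvalues_are_roots /complexified.
split=> [eq_mup|<- z]; last by rewrite map_char_poly.
apply: (map_poly_inj (real_complex R)); apply: monic_eq_mup.
- by rewrite map_monic char_poly_monic.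
- by rewrite map_monic.
- by move=> z; rewrite -eq_mup map_char_poly.
Qed.

(** The expanded form leaves the dimension arbitrary: in dimension 0 every
    matrix is zero. *)
Lemma Cayley_Hamilton_sum {R : comNzRingType} {nu : nat} (A : 'M[R]_nu) :
  \sum_(k < nu.+1) (char_poly A)`_k *: A ^+ k = 0.
Proof.
case: nu A => [|nu] A; first exact: flatmx0.
rewrite -[RHS](Cayley_Hamilton A) -{2}[char_poly A]coefK poly_def.
rewrite size_char_poly linear_sum; apply: eq_bigr => k _.
by rewrite linearZ rmorphXn/= horner_mx_X.
Qed.

(** The transpose of the companion matrix, which is the state matrix of the
    observer canonical form: each state is driven by the preceding one and by
    the last one, the only state that the output row sees. *)
Lemma companion_col {R : comNzRingType} {nu : nat} (q : {poly R}) :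
  q \is monic -> size q = nu.+1 ->
  exists A : 'M[R]_nu, char_poly A = q /\
    forall i j, A i j =
      if j == nu.-1 :> nat then - q`_i else (j.+1 == i :> nat)%:R.
Proof.
move=> q1 /(congr1 predn)/= sq; case: _ / sq.
exists (companionmx q)^T; split.
  rewrite /char_poly -det_tr -[RHS]companionmxK// /char_poly.
  by congr (\det _); apply/matrixP=> i j; rewrite !mxE eq_sym.
by move=> i j; rewrite !mxE.
Qed.

(** * Smooth scalar functions on a product of spaces *)

(** A differentiable function being continuous, asking for continuity at level
    0 would give the same intersection over all k, that is, the same smooth
    functions. *)
Fixpoint class_Ck {R : realType} {V : normedModType R} (k : nat) (f : V -> R) :
    Prop :=
  if k is k'.+1 then
    (forall x, differentiable f x) /\ (forall v, class_Ck k' ('D_v f))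
  else True.

Definition smooth_scalar {R : realType} {V : normedModType R} (f : V -> R) :
  Prop := forall k, class_Ck k f.

Lemma class_CkW {R : realType} {V : normedModType R} (k : nat) (f : V -> R) :
  class_Ck k.+1 f -> class_Ck k f.
Proof.
elim: k f => // k IH f [df Df]; split=> // v.
exact/IH/Df.
Qed.

Lemma class_Ck_cst {R : realType} {V : normedModType R} (k : nat) (c : R) :
  class_Ck k (cst c : V -> R).
Proof.
elim: k c => //= k IH c; split=> [x|v]; first exact: differentiable_cst.
rewrite [X in class_Ck k X](_ : _ = cst 0); first exact: IH.
by apply/funext => x; exact: derive_cst.
Qed.

Lemma class_CkD {R : realType} {V : normedModType R} (k : nat) (f g : V -> R) :
  class_Ck k f -> class_Ck k g -> class_Ck k (f + g).
Proof.
elim: k f g => //= k IH f g [df Df] [dg Dg]; split=> [x|v].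
  exact: differentiableD.
rewrite [X in class_Ck k X](_ : _ = 'D_v f + 'D_v g); first exact: IH.
by apply/funext => x; rewrite deriveD//; apply: diff_derivable.
Qed.

(** Leibniz's rule expresses a derivative of the product by products of
    functions that are C^k, one of the two factors being even C^(k+1). *)
Lemma class_CkM {R : realType} {V : normedModType R} (k : nat) (f g : V -> R) :
  class_Ck k f -> class_Ck k g -> class_Ck k (f * g).
Proof.
elim: k f g => //= k IH f g Cf Cg.
have [[df Df] [dg Dg]] := (Cf, Cg); split=> [x|v]; first exact: differentiableM.
rewrite [X in class_Ck k X](_ : _ = f * 'D_v g + g * 'D_v f).
  by apply: class_CkD; apply: IH => //; exact: class_CkW.
by apply/funext => x; rewrite deriveM//; apply: diff_derivable.
Qed.

Lemma smooth_scalarD {R : realType} {V : normedModType R} (f g : V -> R) :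
  smooth_scalar f -> smooth_scalar g -> smooth_scalar (f + g).
Proof. by move=> Sf Sg k; exact: class_CkD. Qed.

Lemma smooth_scalarM {R : realType} {V : normedModType R} (f g : V -> R) :
  smooth_scalar f -> smooth_scalar g -> smooth_scalar (f * g).
Proof. by move=> Sf Sg k; exact: class_CkM. Qed.

Lemma smooth_scalar_cst {R : realType} {V : normedModType R} (c : R) :
  smooth_scalar (fun _ : V => c).
Proof. by move=> k; exact: class_Ck_cst. Qed.

Lemma smooth_scalarZ {R : realType} {V : normedModType R} (c : R) (f : V -> R) :
  smooth_scalar f -> smooth_scalar (c *: f).
Proof. by move=> Sf; exact/(smooth_scalarM (cst c))/Sf/smooth_scalar_cst. Qed.

Lemma smooth_scalar_sum {R : realType} {V : normedModType R} (n : nat)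
    (f : 'I_n -> V -> R) :
  (forall i, smooth_scalar (f i)) ->
  smooth_scalar (fun w => \sum_(i < n) f i w).
Proof.
move=> Sf; rewrite (_ : (fun _ => _) = \sum_(i < n) f i); last first.
  by apply/funext => w; rewrite fct_sumE.
elim/big_ind : _ => //; first exact: smooth_scalar_cst.
exact: smooth_scalarD.
Qed.

Lemma smooth_scalar_derive {R : realType} {V : normedModType R} (f : V -> R) v :
  smooth_scalar f -> smooth_scalar ('D_v f).
Proof. by move=> Sf k; have [_] := Sf k.+1; exact. Qed.

Lemma smooth_scalar_differentiable {R : realType} {V : normedModType R}
    (f : V -> R) x : smooth_scalar f -> differentiable f x.
Proof. by move=> /(_ 1%N)[]. Qed.

Lemma differentiable_fst {R : realType} {U V : normedModType R} (w : U * V) :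
  differentiable (fst : U * V -> U) w.
Proof. by apply: linear_differentiable => x; exact: cvg_fst. Qed.

Lemma differentiable_snd {R : realType} {U V : normedModType R} (w : U * V) :
  differentiable (snd : U * V -> V) w.
Proof. by apply: linear_differentiable => x; exact: cvg_snd. Qed.

(** Transports smoothness from the state space to the extended space: by the
    chain rule the directional derivatives of a function of w.1 are again
    functions of w.1 of the same kind. *)
Lemma smooth_scalar_fst_coord {R : realType} {n a b : nat}
    {U : normedModType R} (f : 'cV[R]_n -> 'M[R]_(a, b)) i j :
  smooth f -> smooth_scalar (fun w : 'cV[R]_n * U => f w.1 i j).
Proof.
move=> Sf k; move: {Sf}(Sf k); elim: k f => //= k IH f [df Df].
have dff (w : 'cV[R]_n * U) : differentiable (f \o fst) w.
  by apply: differentiable_comp; [exact: differentiable_fst | exact: df].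
have dfi (w : 'cV[R]_n * U) :
    differentiable ((fun N : 'M[R]_(a, b) => N i j : R) \o (f \o fst)) w.
  by apply: differentiable_comp; [exact: dff | exact: differentiable_coord].
split=> [w|v]; first exact: dfi.
pose Df1 (x : 'cV[R]_n) : 'M[R]_(a, b) := 'd f x v.1.
rewrite [X in class_Ck k X](_ : _ = fun w : 'cV[R]_n * U => Df1 w.1 i j).
  exact: (IH Df1 (Df v.1)).
apply/funext => w.
have := @derive_mx R _ a b (f \o fst) w v (diff_derivable (dff w)).
move=> /(congr1 (fun N : 'M[R]_(a, b) => N i j)); rewrite mxE /= => <-.
rewrite deriveE// diff_comp//; last exact: differentiable_fst.
rewrite /= diff_lin// => x; exact: cvg_fst.
Qed.

(** A linear functional is its own differential; continuity comes from its
    expansion in coordinates. *)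
Lemma diff_exo {R : realType} {U : normedModType R} {no : nat}
    (P : 'rV[R]_no) (w : U * 'cV[R]_no) :
  differentiable (fun w => (P *m w.2) 0 0 : R) w /\
  forall v, 'd (fun w => (P *m w.2) 0 0 : R) w v = (P *m v.2) 0 0.
Proof.
set phi := fun _ => _.
have phi_lin : linear phi.
  by move=> a u v; rewrite /phi mulmxDr -scalemxAr !mxE.
pose phiM := GRing.isLinear.Build _ _ _ _ phi phi_lin.
pose phiL : {linear _ -> _} := HB.pack phi phiM.
have phi_cts : continuous phi.
  move=> u; apply: differentiable_continuous.
  have -> : phi = \sum_(k < no) P 0 k *: (fun w : U * 'cV[R]_no => w.2 k 0 : R).
    by apply/funext => v; rewrite fct_sumE /phi mxE.
  apply: differentiable_sum => k; apply: differentiableZ.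
  apply: (@differentiable_comp _ _ _ _ snd (fun N : 'cV[R]_no => N k 0)).
    exact: differentiable_snd.
  exact: differentiable_coord.
split=> [|v]; first exact: (@linear_differentiable _ _ _ phiL).
by rewrite (@diff_lin _ _ _ phiL).
Qed.

Lemma smooth_scalar_exo {R : realType} {U : normedModType R} {no : nat}
    (P : 'rV[R]_no) : smooth_scalar (fun w : U * 'cV[R]_no => (P *m w.2) 0 0).
Proof.
case=> // k; split=> [w|v]; first exact: (diff_exo P w).1.
rewrite [X in class_Ck k X](_ : _ = cst ((P *m v.2) 0 0)).
  exact: class_Ck_cst.
apply/funext => w; rewrite deriveE; last exact: (diff_exo P w).1.
exact: (diff_exo P w).2.
Qed.

(** * The Lie derivative as a derivation along the disturbance-free flow *)

Lemma lie_Fe_smooth {R : realType} {n p m no : nat}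
    (sys : exo_system R n p m no) (phi : 'cV[R]_n * 'cV[R]_no -> R) :
  smooth_scalar phi -> smooth_scalar (lie_Fe sys phi).
Proof.
move=> Sphi; apply: smooth_scalarD; first apply: smooth_scalarD.
- apply: smooth_scalar_sum => k; apply: smooth_scalarM.
    exact/smooth_scalar_fst_coord/smooth_sysF.
  exact: smooth_scalar_derive.
- apply: smooth_scalarM; first exact: smooth_scalar_exo.
  apply: smooth_scalar_sum => k; apply: smooth_scalarM.
    exact/smooth_scalar_fst_coord/smooth_sysG.
  exact: smooth_scalar_derive.
- apply: smooth_scalar_sum => k; apply: smooth_scalarM.
    exact: smooth_scalar_exo.
  exact: smooth_scalar_derive.
Qed.

Lemma iter_lie_Fe_smooth {R : realType} {n p m no : nat}
    (sys : exo_system R n p m no) (phi : 'cV[R]_n * 'cV[R]_no -> R) k :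
  smooth_scalar phi -> smooth_scalar (iter k (lie_Fe sys) phi).
Proof. by move=> Sphi; elim: k => //= k; exact: lie_Fe_smooth. Qed.

(** Needed so that all the Lie derivatives of the output exist. *)
Lemma smooth_scalar_output {R : realType} {n p m no : nat}
    (sys : exo_system R n p m no) (b : 'rV[R]_p) :
  smooth_scalar (fun w => (b *m free_output sys w) 0 0).
Proof.
rewrite (_ : (fun _ => _) = (fun w => \sum_(l < p) b 0 l *
    (sysH sys w.1 l 0 + sysJ sys w.1 l 0 * (sysQ sys *m w.2) 0 0))).
  apply: smooth_scalar_sum => l; apply: smooth_scalarM.
    exact: smooth_scalar_cst.
  apply: smooth_scalarD; first exact/smooth_scalar_fst_coord/smooth_sysH.
  apply: smooth_scalarM; first exact/smooth_scalar_fst_coord/smooth_sysJ.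
  exact: smooth_scalar_exo.
apply/funext => w; rewrite mxE; apply: eq_bigr => l _.
by rewrite /free_output !mxE big_ord1 !mxE.
Qed.

(** The sum of partial derivatives is the differential evaluated on the
    drift vector, once the latter is expanded in the canonical basis.  All
    linearity properties of the Lie derivative follow from this form. *)
Lemma lie_FeE {R : realType} {n p m no : nat} (sys : exo_system R n p m no)
    (phi : 'cV[R]_n * 'cV[R]_no -> R) w : differentiable phi w ->
  lie_Fe sys phi w = 'd phi w
    (sysF sys w.1 + sysG sys w.1 *m (sysQ sys *m w.2), sysR sys *m w.2).
Proof.
move=> dphi; set u := _ + _; set v := sysR sys *m _.
have -> : (u, v) = \sum_(k < n) u k 0 *: ((delta_mx k 0, 0) : 'cV[R]_n * 'cV[R]_no)
    + \sum_(k < no) v k 0 *: ((0, delta_mx k 0) : 'cV[R]_n * 'cV[R]_no).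
  rewrite [u in LHS]matrix_sum_delta [v in LHS]matrix_sum_delta.
  under [X in (X, _)]eq_bigr do rewrite big_ord1.
  under [X in (_, X)]eq_bigr do rewrite big_ord1.
  have sum_pairE (I : finType) (F : I -> 'cV[R]_n * 'cV[R]_no) :
    \sum_i F i = (\sum_i (F i).1, \sum_i (F i).2).
    by rewrite [LHS]surjective_pairing !raddf_sum.
  rewrite !sum_pairE /=.
  have sum0 (V : lmodType R) (I : finType) (c : I -> R) :
    \sum_i c i *: (0 : V) = 0 by rewrite big1// => i _; rewrite scaler0.
  by rewrite !sum0 -[RHS]/(_ + _, _ + _) addr0 add0r.
rewrite [RHS](linearD ('d phi w)) !(linear_sum ('d phi w)) /lie_Fe; congr (_ + _).
  rewrite mulr_sumr -big_split/=; apply: eq_bigr => k _.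
  have -> : u k 0 = sysF sys w.1 k 0
      + (sysQ sys *m w.2) 0 0 * sysG sys w.1 k 0.
    by rewrite [LHS]mxE [X in _ + X]mxE big_ord1 [X in _ + X]mulrC.
  by rewrite linearZ /pd_x deriveE//= mulrA -mulrDl.
apply: eq_bigr => k _; rewrite linearZ /pd_xo deriveE//.
by congr (_ * _); rewrite -row_mul mxE.
Qed.

Lemma lie_FeD {R : realType} {n p m no : nat} (sys : exo_system R n p m no)
    (phi psi : 'cV[R]_n * 'cV[R]_no -> R) :
  (forall w, differentiable phi w) -> (forall w, differentiable psi w) ->
  lie_Fe sys (phi + psi) = lie_Fe sys phi + lie_Fe sys psi.
Proof.
move=> dphi dpsi; apply/funext => w; rewrite [RHS]/= /GRing.add/=.
rewrite !lie_FeE//; last exact: differentiableD.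
by rewrite diffD.
Qed.

Lemma lie_FeZ {R : realType} {n p m no : nat} (sys : exo_system R n p m no)
    (c : R) (phi : 'cV[R]_n * 'cV[R]_no -> R) :
  (forall w, differentiable phi w) ->
  lie_Fe sys (c *: phi) = c *: lie_Fe sys phi.
Proof.
move=> dphi; apply/funext => w; rewrite [RHS]/= /GRing.scale/=.
rewrite !lie_FeE//; last exact: differentiableZ.
by rewrite diffZ.
Qed.

Lemma lie_Fe_exo {R : realType} {n p m no : nat} (sys : exo_system R n p m no)
    (P : 'rV[R]_no) :
  lie_Fe sys (fun w => (P *m w.2) 0 0)
    = (fun w => (P *m sysR sys *m w.2) 0 0).
Proof.
apply/funext => w; rewrite lie_FeE; last exact: (diff_exo P w).1.
by rewrite (diff_exo P w).2/= mulmxA.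
Qed.

Lemma iter_lie_Fe_exo {R : realType} {n p m no : nat}
    (sys : exo_system R n p m no) (P : 'rV[R]_no) k :
  iter k (lie_Fe sys) (fun w => (P *m w.2) 0 0)
    = (fun w => (P *m sysR sys ^+ k *m w.2) 0 0).
Proof.
elim: k => [|k IH]; first by rewrite expr0 mulmx1.
by rewrite iterS IH lie_Fe_exo exprSr -mulmxE mulmxA.
Qed.

(** Links the matrix form of condition (i) of an observer to the scalar Lie
    derivative: both sides are the same sum of partial derivatives. *)
Lemma lie_Fe_coord {R : realType} {n p m no nu : nat}
    (sys : exo_system R n p m no) (T : 'cV[R]_n * 'cV[R]_no -> 'cV[R]_nu)
    x xo i :
  (jac_x T (x, xo) *m (sysF sys x + sysG sys x *m (sysQ sys *m xo))
        + jac_xo T (x, xo) *m (sysR sys *m xo)) i 0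
    = lie_Fe sys (fun w => T w i 0) (x, xo).
Proof.
rewrite /lie_Fe [LHS]mxE mulmxDr [X in X + _]mxE; congr (_ + _ + _).
- by rewrite mxE; apply: eq_bigr => k _; rewrite mxE mulrC.
- rewrite mulmxA mxE big_ord1 mulrC; congr (_ * _).
  by rewrite mxE; apply: eq_bigr => k _; rewrite mxE mulrC.
- rewrite mxE; apply: eq_bigr => k _; rewrite mxE mulrC.
  by rewrite -row_mul [in RHS]mxE.
Qed.

(** Regularity along the flow that makes all iterates of the Lie derivative
    additive.  Smooth functions have it, and so do the constant combinations of
    the components of an observer's state map, which need not be smooth. *)
Definition lie_differentiable {R : realType} {n p m no : nat}
    (sys : exo_system R n p m no) (phi : 'cV[R]_n * 'cV[R]_no -> R) : Prop :=
  forall k w, differentiable (iter k (lie_Fe sys) phi) w.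

Lemma smooth_lie_differentiable {R : realType} {n p m no : nat}
    (sys : exo_system R n p m no) (phi : 'cV[R]_n * 'cV[R]_no -> R) :
  smooth_scalar phi -> lie_differentiable sys phi.
Proof.
by move=> Sphi k w; exact/smooth_scalar_differentiable/iter_lie_Fe_smooth.
Qed.

Lemma iter_lie_FeD {R : realType} {n p m no : nat}
    (sys : exo_system R n p m no) (phi psi : 'cV[R]_n * 'cV[R]_no -> R) k :
  lie_differentiable sys phi -> lie_differentiable sys psi ->
  iter k (lie_Fe sys) (phi + psi)
    = iter k (lie_Fe sys) phi + iter k (lie_Fe sys) psi.
Proof. by move=> dphi dpsi; elim: k => // k IH; rewrite !iterS IH lie_FeD. Qed.

Lemma iter_lie_FeZ {R : realType} {n p m no : nat}
    (sys : exo_system R n p m no) (c : R)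
    (phi : 'cV[R]_n * 'cV[R]_no -> R) k :
  lie_differentiable sys phi ->
  iter k (lie_Fe sys) (c *: phi) = c *: iter k (lie_Fe sys) phi.
Proof. by move=> dphi; elim: k => // k IH; rewrite !iterS IH lie_FeZ. Qed.

Lemma lie_Fe_sum {R : realType} {n p m no : nat} (sys : exo_system R n p m no)
    (N : nat) (phi : 'I_N -> 'cV[R]_n * 'cV[R]_no -> R) :
  (forall i w, differentiable (phi i) w) ->
  lie_Fe sys (\sum_(i < N) phi i) = \sum_(i < N) lie_Fe sys (phi i).
Proof.
move=> dphi; elim: N phi dphi => [|N IH] phi dphi.
  apply/funext => w; rewrite !big_ord0 lie_FeE; last exact: differentiable_cst.
  by rewrite diff_cst.
rewrite !big_ord_recr/= lie_FeD ?IH// => w.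
exact: differentiable_sum.
Qed.

Lemma iter_lie_Fe_sum {R : realType} {n p m no : nat}
    (sys : exo_system R n p m no)
    (N : nat) (phi : 'I_N -> 'cV[R]_n * 'cV[R]_no -> R) k :
  (forall i, lie_differentiable sys (phi i)) ->
  iter k (lie_Fe sys) (\sum_(i < N) phi i)
    = \sum_(i < N) iter k (lie_Fe sys) (phi i).
Proof.
move=> dphi; elim: k => // k IH; rewrite !iterS IH lie_Fe_sum// => i w.
exact: dphi.
Qed.

Definition lie_output {R : realType} {n p m no : nat}
    (sys : exo_system R n p m no) (k : nat) w : 'cV[R]_p :=
  \col_l iter k (lie_Fe sys)
    (fun w => ((delta_mx 0 l : 'rV[R]_p) *m free_output sys w) 0 0) w.

Lemma row_mul_lin_comb {R : realType} {V : Type} {p : nat} (b : 'rV[R]_p)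
    (h : V -> 'cV[R]_p) :
  (fun w => (b *m h w) 0 0) = \sum_(l < p) b 0 l *: (fun w => h w l 0).
Proof. by apply/funext => w; rewrite fct_sumE mxE. Qed.

(** Iterated Lie derivatives of the outputs depend linearly on the constant
    row that weights them, so identities between them reduce to matrix
    algebra. *)
Lemma iter_lie_Fe_output {R : realType} {n p m no : nat}
    (sys : exo_system R n p m no) (b : 'rV[R]_p) k w :
  iter k (lie_Fe sys) (fun w => (b *m free_output sys w) 0 0) w
    = (b *m lie_output sys k w) 0 0.
Proof.
have deltaE l : (fun w => free_output sys w l 0)
    = (fun w => ((delta_mx 0 l : 'rV[R]_p) *m free_output sys w) 0 0).
  by apply/funext => u; rewrite -rowE [RHS]mxE.
have Sh l : smooth_scalar (fun w => free_output sys w l 0).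
  by rewrite deltaE; exact: smooth_scalar_output.
rewrite row_mul_lin_comb iter_lie_Fe_sum => [|l]; last first.
  exact/smooth_lie_differentiable/smooth_scalarZ.
rewrite fct_sumE mxE; apply: eq_bigr => l _.
rewrite iter_lie_FeZ; last exact: smooth_lie_differentiable.
by rewrite /lie_output mxE -deltaE.
Qed.

Lemma differentiable_col_coord {R : realType} {V : normedModType R} {a : nat}
    (T : V -> 'cV[R]_a) w i :
  differentiable T w -> differentiable (fun w => T w i 0 : R) w.
Proof.
move=> dT.
apply: (@differentiable_comp _ _ _ _ T (fun N : 'cV[R]_a => N i 0)) => //.
exact: differentiable_coord.
Qed.

Lemma differentiable_row_mul {R : realType} {V : normedModType R} {a : nat}
    (c : 'rV[R]_a) (T : V -> 'cV[R]_a) w :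
  differentiable T w -> differentiable (fun w => (c *m T w) 0 0 : R) w.
Proof.
move=> dT; rewrite row_mul_lin_comb; apply: differentiable_sum => i.
exact/differentiableZ/differentiable_col_coord.
Qed.

(** Variation of constants for L T = A T + B h.  The map T is merely
    differentiable, and it is the formula itself that shows, along the
    induction, that the next Lie derivative can be taken termwise. *)
Lemma iter_lie_Fe_observer {R : realType} {n p m no nu : nat}
    (sys : exo_system R n p m no) (T : 'cV[R]_n * 'cV[R]_no -> 'cV[R]_nu)
    (A : 'M[R]_nu) (B : 'M[R]_(nu, p)) :
  (forall w, differentiable T w) ->
  (forall x xo,
      jac_x T (x, xo) *m (sysF sys x + sysG sys x *m (sysQ sys *m xo))
        + jac_xo T (x, xo) *m (sysR sys *m xo)
      = A *m T (x, xo) + B *m free_output sys (x, xo)) ->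
  forall (c : 'rV[R]_nu) k,
  iter k (lie_Fe sys) (fun w => (c *m T w) 0 0)
    = (fun w => (c *m A ^+ k *m T w) 0 0)
      + \sum_(i < k) iter i (lie_Fe sys)
          (fun w => (c *m A ^+ (k - i.+1) *m B *m free_output sys w) 0 0).
Proof.
move=> dT eqT.
have dTi (i : 'I_nu) w : differentiable (fun w => T w i 0) w.
  exact: differentiable_col_coord.
have dcT (c : 'rV[R]_nu) w : differentiable (fun w => (c *m T w) 0 0) w.
  exact: differentiable_row_mul.
have lieT (c : 'rV[R]_nu) : lie_Fe sys (fun w => (c *m T w) 0 0)
    = (fun w => (c *m A *m T w) 0 0)
      + (fun w => (c *m B *m free_output sys w) 0 0).
  apply/funext => -[x xo]; rewrite row_mul_lin_comb lie_Fe_sum; last first.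
    by move=> i w; exact: differentiableZ.
  rewrite -[RHS]/(_ + _) -!mulmxA.
  transitivity ((c *m A *m T (x, xo) + c *m B *m free_output sys (x, xo)) 0 0);
    last by rewrite [LHS]mxE !mulmxA.
  rewrite -!mulmxA -mulmxDr -eqT mxE fct_sumE; apply: eq_bigr => i _.
  by rewrite lie_FeZ// lie_Fe_coord.
move=> c; elim=> [|k IH]; first by rewrite big_ord0 addr0 expr0 mulmx1.
have deta (i : nat) (b : 'rV[R]_p) w : differentiable
    (iter i (lie_Fe sys) (fun w => (b *m free_output sys w) 0 0)) w.
  exact/smooth_scalar_differentiable/iter_lie_Fe_smooth/smooth_scalar_output.
rewrite iterS IH lie_FeD//; last by move=> w; exact: differentiable_sum.
rewrite lieT lie_Fe_sum// big_ord_recl/= subn1/= addrA exprSr -mulmxE !mulmxA.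
by congr (_ + _).
Qed.

(** * From an observer to the output identity *)

(** Apply q(L) to z = C T + D h.  The terms in T carry the factor q(A), which
    is zero; gam i collects the coefficient of L^i h. *)
Lemma observer_output_identity {R : realType} {n p m no nu : nat}
    (sys : exo_system R n p m no) (alpha : 'I_nu -> R)
    (A : 'M[R]_nu) (B : 'M[R]_(nu, p)) (C : 'rV[R]_nu) (D : 'rV[R]_p) :
  functional_observer sys A B C D -> char_poly A = monic_of alpha ->
  exists beta : 'I_nu.+1 -> 'rV[R]_p,
     forall (x : 'cV[R]_n) (xo : 'cV[R]_no),
       \sum_(j < nu.+1)
         iter (nu - j) (lie_Fe sys)
           (fun w => (beta j *m free_output sys w) 0 0) (x, xo)
       = (sysQ sys *m (sysR sys ^+ nu
                  + \sum_(k < nu) alpha k *: sysR sys ^+ (nu - k.+1)) *m xo) 0 0.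
Proof.
move=> [_ [T [dT [eqT eqQ]]]] cpA; set q := monic_of alpha in cpA *.
pose gam (i : nat) : 'rV[R]_p := q`_i *: D
  + \sum_(k < nu.+1 | (i < k)%N) q`_k *: (C *m A ^+ (k - i.+1) *m B).
(* beta_j multiplies the derivative of order nu - j. *)
exists (fun j => gam (nu - j)%N) => x xo; rewrite monic_of_eval.
set Y := fun k => lie_output sys k (x, xo).
have exoE k : (sysQ sys *m sysR sys ^+ k *m xo)
   = C *m A ^+ k *m T (x, xo) + D *m Y k
     + \sum_(i < k) C *m A ^+ (k - i.+1) *m B *m Y i.
  apply/matrixP => i j; rewrite !ord1.
  have /(congr1 (fun phi => phi (x, xo))) :=
    esym (iter_lie_Fe_exo sys (sysQ sys) k).
  move=> /= ->.
  have -> : (fun w => (sysQ sys *m w.2) 0 0) = (fun w => (C *m T w) 0 0)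
      + (fun w => (D *m free_output sys w) 0 0).
    apply/funext => -[u uo]; rewrite -[RHS]/(_ + _) -(eqQ u uo).
    by rewrite [LHS]mxE.
  rewrite iter_lie_FeD; first last.
  - exact/smooth_lie_differentiable/smooth_scalar_output.
  - move=> l w; rewrite (iter_lie_Fe_observer sys T A B dT eqT).
    apply: differentiableD; first exact: differentiable_row_mul.
    apply: differentiable_sum => i'.
    exact/smooth_scalar_differentiable/iter_lie_Fe_smooth/smooth_scalar_output.
  rewrite (iter_lie_Fe_observer sys T A B dT eqT).
  rewrite -[LHS]/(_ + _) iter_lie_Fe_output -[X in X + _]/(_ + _) fct_sumE.
  rewrite addrAC [RHS]mxE [X in _ = X + _]mxE summxE; congr (_ + _ + _).
  by apply: eq_bigr => l _; rewrite iter_lie_Fe_output.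
have yE : \sum_(k < nu.+1) q`_k *: (sysQ sys *m sysR sys ^+ k *m xo)
    = \sum_(i < nu.+1) gam i *m Y i.
  under eq_bigr do rewrite exoE !scalerDr.
  rewrite !big_split/=.
  rewrite [X in X + _ + _](_ : _ = 0) ?add0r; last first.
    rewrite -[RHS](mul0mx _ (T (x, xo))) -[X in X *m _](mulmx0 _ C).
    rewrite -(Cayley_Hamilton_sum A) mulmx_sumr mulmx_suml.
    by apply: eq_bigr => k _; rewrite cpA -scalemxAr -scalemxAl.
  rewrite /gam; under [RHS]eq_bigr do rewrite mulmxDl mulmx_suml -scalemxAl.
  rewrite big_split/=; congr (_ + _).
  rewrite [RHS](exchange_big_dep xpredT)//=; apply: eq_bigr => k _.
  rewrite scaler_sumr (big_ord_widen nu.+1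
    (fun i => q`_k *: (C *m A ^+ (k - i.+1) *m B *m Y i)) (ltnW (ltn_ord k))).
  by apply: eq_bigr => i _; rewrite scalemxAl.
rewrite (reindex_inj rev_ord_inj)/=.
transitivity ((\sum_(i < nu.+1) gam i *m Y i) 0 0).
  rewrite summxE; apply: eq_bigr => i _.
  have -> : (nu - (nu.+1 - i.+1) = i)%N by rewrite subSS subKn// -ltnS.
  by rewrite iter_lie_Fe_output.
rewrite -yE mulmx_sumr mulmx_suml; congr (fun_of_matrix _ _ _).
by apply: eq_bigr => k _; rewrite -scalemxAr -scalemxAl.
Qed.

(** * From the output identity to an observer *)

Lemma differentiable_col {R : realType} {V : normedModType R} {a : nat}
    (T : V -> 'cV[R]_a) w :
  (forall i, differentiable (fun w => T w i 0 : R) w) -> differentiable T w.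
Proof.
move=> dT; have -> : T = \sum_(i < a) (fun w => T w i 0 *: (delta_mx i 0 : 'cV[R]_a)).
  apply/funext => u; rewrite fct_sumE [LHS]matrix_sum_delta.
  by apply: eq_bigr => i _; rewrite big_ord1.
by apply: differentiable_sum => i; exact: differentiableZl.
Qed.

(** The function S_k = sum_(j<=k) L^(k-j) u_j, with
    u_j = q_(nu-j) z - beta_j h.  The index k ranges over all naturals so
    that S_(k+1) always makes sense; hence the default value hidden in
    inord. *)
Definition observer_chain {R : realType} {n p m no nu : nat}
    (sys : exo_system R n p m no) (alpha : 'I_nu -> R)
    (beta : 'I_nu.+1 -> 'rV[R]_p) (k : nat) (w : 'cV[R]_n * 'cV[R]_no) : R :=
  \sum_(j < k.+1) iter (k - j) (lie_Fe sys)
    (fun w => (((monic_of alpha)`_(nu - j) *: sysQ sys) *m w.2) 0 0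
       + (- beta (inord j) *m free_output sys w) 0 0) w.

Lemma smooth_innovation {R : realType} {n p m no : nat}
    (sys : exo_system R n p m no) (P : 'rV[R]_no) (b : 'rV[R]_p) :
  smooth_scalar (fun w => (P *m w.2) 0 0 + (b *m free_output sys w) 0 0).
Proof. exact/smooth_scalarD/smooth_scalar_output/smooth_scalar_exo. Qed.

Lemma smooth_observer_chain {R : realType} {n p m no nu : nat}
    (sys : exo_system R n p m no) (alpha : 'I_nu -> R)
    (beta : 'I_nu.+1 -> 'rV[R]_p) (k : nat) :
  smooth_scalar (observer_chain sys alpha beta k).
Proof.
apply: smooth_scalar_sum => j; apply: iter_lie_Fe_smooth.
exact: smooth_innovation.
Qed.

(** L raises by one the order of every term of S_k; compared with S_(k+1),
    only the new undifferentiated term u_(k+1) is lacking. *)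
Lemma lie_Fe_observer_chain {R : realType} {n p m no nu : nat}
    (sys : exo_system R n p m no) (alpha : 'I_nu -> R)
    (beta : 'I_nu.+1 -> 'rV[R]_p) (k : nat) w :
  lie_Fe sys (observer_chain sys alpha beta k) w
    = observer_chain sys alpha beta k.+1 w
      - (((monic_of alpha)`_(nu - k.+1) *: sysQ sys *m w.2) 0 0
         + (- beta (inord k.+1) *m free_output sys w) 0 0).
Proof.
rewrite /observer_chain big_ord_recr/= subnn addrK -fct_sumE.
rewrite lie_Fe_sum => [|j u]; last first.
  exact/smooth_scalar_differentiable/iter_lie_Fe_smooth/smooth_innovation.
rewrite fct_sumE; apply: eq_bigr => j _.
by rewrite -iterS subSn// -ltnS.
Qed.

(** The chain closes up exactly by the output identity, since
    L^(nu-j) z = Q R^(nu-j) xo. *)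
Lemma observer_chain_last {R : realType} {n p m no nu : nat}
    (sys : exo_system R n p m no) (alpha : 'I_nu -> R)
    (beta : 'I_nu.+1 -> 'rV[R]_p) x xo :
  \sum_(j < nu.+1)
         iter (nu - j) (lie_Fe sys)
           (fun w => (beta j *m free_output sys w) 0 0) (x, xo)
       = (sysQ sys *m (sysR sys ^+ nu
                  + \sum_(k < nu) alpha k *: sysR sys ^+ (nu - k.+1)) *m xo) 0 0 ->
  observer_chain sys alpha beta nu (x, xo) = 0.
Proof.
move=> eq_beta; rewrite /observer_chain.
have stepE (j : 'I_nu.+1) : iter (nu - j) (lie_Fe sys)
    (fun w => (((monic_of alpha)`_(nu - j) *: sysQ sys) *m w.2) 0 0
       + (- beta (inord j) *m free_output sys w) 0 0) (x, xo)
  = ((monic_of alpha)`_(nu - j) *: sysQ sys *m sysR sys ^+ (nu - j) *m xo) 0 0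
    - iter (nu - j) (lie_Fe sys)
           (fun w => (beta j *m free_output sys w) 0 0) (x, xo).
  rewrite iter_lie_FeD; first last.
  - exact/smooth_lie_differentiable/smooth_scalar_output.
  - exact/smooth_lie_differentiable/smooth_scalar_exo.
  rewrite -[LHS]/(_ + _) iter_lie_Fe_exo !iter_lie_Fe_output inord_val mulNmx.
  by congr (_ + _); rewrite [LHS]mxE.
under eq_bigr do rewrite stepE.
rewrite big_split/= sumrN eq_beta monic_of_eval; apply/eqP; rewrite subr_eq0.
apply/eqP; rewrite mulmx_sumr mulmx_suml summxE.
rewrite [RHS](reindex_inj rev_ord_inj)/=; apply: eq_bigr => j _.
by rewrite subSS -scalemxAr -!scalemxAl.
Qed.

(** The states are the functions S_k in reversed order, so that the last state
    is S_0 = z - beta_0 h, from which D = beta_0 recovers z.  Substituting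
    z = S_0 + beta_0 h in L S_k = S_(k+1) - u_(k+1) splits the right-hand side
    into -q_i S_0 + S_(k+1), a row of A T, and
    (beta_(k+1) - q_i beta_0) h, a row of B h, where i = nu - k - 1. *)
Lemma observer_of_output_identity {R : realType} {n p m no nu : nat}
    (nu_gt0 : (0 < nu)%N)
    (sys : exo_system R n p m no) (alpha : 'I_nu -> R)
    (beta : 'I_nu.+1 -> 'rV[R]_p) :
  (forall x xo, observer_chain sys alpha beta nu (x, xo) = 0) ->
  exists (A : 'M[R]_nu) (B : 'M[R]_(nu, p)) (C : 'rV[R]_nu) (D : 'rV[R]_p)
      (T : 'cV[R]_n * 'cV[R]_no -> 'cV[R]_nu),
    [/\ char_poly A = monic_of alpha,
     (forall w, differentiable T w),
    (forall x xo,
      jac_x T (x, xo) *m (sysF sys x + sysG sys x *m (sysQ sys *m xo))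
        + jac_xo T (x, xo) *m (sysR sys *m xo)
      = A *m T (x, xo) + B *m free_output sys (x, xo)) &
    (forall x xo,
      C *m T (x, xo) + D *m free_output sys (x, xo) = sysQ sys *m xo)].
Proof.
case: nu nu_gt0 alpha beta => // nu _ alpha beta S_last.
set q := monic_of alpha; pose S := observer_chain sys alpha beta.
have [A [cpA AE]] := companion_col q (monic_of_monic alpha) (size_monic_of alpha).
pose T w : 'cV[R]_nu.+1 := \col_i S (nu - i)%N w.
have S0 w : S 0%N w = (sysQ sys *m w.2) 0 0 - (beta 0 *m free_output sys w) 0 0.
  rewrite /S /observer_chain big_ord1 subnn subn0 coef_monic_of_lead scale1r/=.
  rewrite mulNmx [X in _ + X]mxE; congr (_ - (beta _ *m _) _ _).
  by apply: val_inj; rewrite /= inordK.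
exists A, (\matrix_(i, l) (beta (inord (nu.+1 - i)) 0 l - q`_i * beta 0 0 l)).
exists (delta_mx 0 ord_max), (beta 0), T; split=> // [w|x xo|x xo].
- apply: differentiable_col => i.
  rewrite (_ : (fun _ => _) = S (nu - i)%N); last by apply/funext => u; rewrite mxE.
  exact/smooth_scalar_differentiable/smooth_observer_chain.
- apply/matrixP => i j; rewrite ord1 lie_Fe_coord.
  rewrite (_ : (fun _ => _) = S (nu - i)%N); last by apply/funext => u; rewrite mxE.
  have le_i : (i <= nu)%N by rewrite -ltnS.
  have Ei : (nu.+1 - (nu - i).+1 = i)%N by rewrite subSS subKn.
  rewrite (lie_Fe_observer_chain sys alpha beta (nu - i)) Ei -subSn// -/q -/S.
  rewrite [RHS]mxE.
  (* For i = 0 no state precedes; the missing term is S (nu.+1), which is 0. *)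
  have -> : (A *m T (x, xo)) i 0 = S (nu.+1 - i)%N (x, xo) - q`_i * S 0%N (x, xo).
    rewrite mxE big_ord_recr/= AE eqxx mxE subnn mulNr; congr (_ - _).
    case: i {le_i Ei} => -[|i] lti.
      rewrite big1 ?S_last// => k _; rewrite AE/= ltn_eqF// mul0r//.
    rewrite (bigD1 (Ordinal (lti : i < nu)%N))//= big1 ?addr0.
      by rewrite AE mxE/= eqxx ltn_eqF// mul1r subSS.
    move=> k; rewrite -val_eqE/= => /negbTE ki.
    by rewrite AE/= ltn_eqF// eqSS ki mul0r.
  have -> : ((\matrix_(i, l) (beta (inord (nu.+1 - i)) 0 l - q`_i * beta 0 0 l))
      *m free_output sys (x, xo)) i 0
    = (beta (inord (nu.+1 - i)) *m free_output sys (x, xo)) 0 0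
      - q`_i * (beta 0 *m free_output sys (x, xo)) 0 0.
    rewrite !mxE mulr_sumr -sumrB; apply: eq_bigr => l _.
    by rewrite mxE mulrBl mulrA.
  rewrite S0 mulNmx -scalemxAl [in X in _ - (X + _)]mxE [in X in _ - (_ + X)]mxE.
  by ring.
- apply/matrixP => i j; rewrite !ord1 -rowE [LHS]mxE [X in X + _]mxE [X in X + _]mxE.
  by rewrite subnn S0 subrK.
Qed.

Theorem proposition3 (R : realType) (n p m no nu : nat)
  (n_gt0 : (0 < n)%N) (p_gt0 : (0 < p)%N) (m_gt0 : (0 < m)%N)
  (no_gt0 : (0 < no)%N) (nu_gt0 : (0 < nu)%N)
  (sys : exo_system R n p m no) (alpha : 'I_nu -> R)
  (alpha_stable : forall z : R[i],
     root (complexified (monic_of alpha)) z -> complex.Re z < 0) :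
  (exists (A : 'M[R]_nu) (B : 'M[R]_(nu, p)) (C : 'rV[R]_nu) (D : 'rV[R]_p),
     functional_observer sys A B C D /\
     eigenvalues_are_roots A (monic_of alpha))
  <->
  (exists beta : 'I_nu.+1 -> 'rV[R]_p,
     forall (x : 'cV[R]_n) (xo : 'cV[R]_no),
       \sum_(j < nu.+1)
         iter (nu - j) (lie_Fe sys)
           (fun w => (beta j *m free_output sys w) 0 0) (x, xo)
       = (sysQ sys *m (sysR sys ^+ nu
                  + \sum_(k < nu) alpha k *: sysR sys ^+ (nu - k.+1)) *m xo) 0 0).
Proof.
have eigP A := eigenvalues_are_rootsP A (monic_of alpha) (monic_of_monic alpha).
split=> [[A [B [C [D [obs /eigP cpA]]]]]|[beta eq_beta]].
  exact: observer_output_identity obs cpA.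
have [A [B [C [D [T [cpA dT eqT eqQ]]]]]] :=
  observer_of_output_identity nu_gt0 sys alpha beta
    (fun x xo => observer_chain_last sys alpha beta x xo (eq_beta x xo)).
exists A, B, C, D; split; last exact/eigP.
split; last by exists T.
move=> z; rewrite eigenvalue_root_char -map_char_poly cpA.
exact: alpha_stable.
Qed.
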